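(* Let $n$ and $k$ be positive integers such that $k \le \tfrac{n}{2} - 1$. Let $$X_0(n,k) = \{ (\lambda_1, k, \lambda_3)\vdash n \mid k \equiv \lambda_3 \pmod{2}\}$$ and $$X_1(n,k) = \{ (\lambda_1, k, \lambda_3)\vdash n \mid k \not\equiv \lambda_3 \pmod{2} \}.$$ If $k \leq \lceil\frac{n}{3}\rceil$ or if $k \equiv n \pmod{2}$, then $$\sum_{\lambda \in X_0(n,k)} f^\lambda = f^{(k,k, 1^{n-2k})} + f^{(k+1,k+1,1^{n-2k-2})}$$ and $$\sum_{\lambda \in X_1(n,k)} f^\lambda = f^{(k+1,k,1^{n-2k-1})}.$$ If $k > \lceil\frac{n}{3}\rceil$ and $k \not \equiv n \pmod{2}$, then these equalities hold with the roles of $X_0$ and $X_1$ switched, that is, $$\sum_{\lambda \in X_1(n,k)} f^\lambda = f^{(k,k, 1^{n-2k})} + f^{(k+1,k+1,1^{n-2k-2})} \quad\text{and}\quad \sum_{\lambda \in X_0(n,k)} f^\lambda = f^{(k+1,k,1^{n-2k-1})}.$$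
   Context: For a partition $\lambda\vdash n$, $f^\lambda$ denotes the number of standard Young tableaux of shape $\lambda$; equivalently, $f^\lambda$ is the degree of the irreducible complex character of the symmetric group $\Sigma_n$ labeled by $\lambda$. In a three-part partition $(\lambda_1,\lambda_2,\lambda_3)\vdash n$ parts are allowed to be zero, so it is a triple of integers with $\lambda_1\ge\lambda_2\ge\lambda_3\ge 0$ and $\lambda_1+\lambda_2+\lambda_3=n$. In $(a,b,1^t)$ the notation $1^t$ means $t$ parts equal to $1$ (none if $t=0$). *)

(* Defs.v *)
From mathcomp Require Import all_boot.

Set Implicit Arguments.
Unset Strict Implicit.
Unset Printing Implicit Defensive.

Definition is_partition_of (n : nat) (s : seq nat) : bool :=
  sorted geq s && (sumn s == n).

(* The Young diagram of s; parts equal to 0 give empty rows, so they do not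
   affect the diagram. *)
Definition cell (s : seq nat) : finType := {i : 'I_(size s) & 'I_(nth 0 s i)}.

Definition cell_row (s : seq nat) (x : cell s) : nat := tag x.
Definition cell_col (s : seq nat) (x : cell s) : nat := tagged x.

Lemma card_cell (s : seq nat) : #|cell s| = sumn s.
Proof.
rewrite card_tagged; congr sumn.
rewrite -[RHS](mkseq_nth 0) /mkseq -val_enum_ord -map_comp.
by apply: eq_map => i /=; rewrite card_ord.
Qed.

(* Entries are numbered from 0; by card_cell, an injective filling uses every
   entry exactly once. *)
Definition is_standard (s : seq nat) (t : {ffun cell s -> 'I_(sumn s)}) : bool :=
  [&& injectiveb t,
      [forall x, forall y,
         (cell_row x == cell_row y) && (cell_col x < cell_col y) ==> (t x < t y)]
    & [forall x, forall y,
         (cell_col x == cell_col y) && (cell_row x < cell_row y) ==> (t x < t y)]].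

Definition SYT (s : seq nat) : {set {ffun cell s -> 'I_(sumn s)}} :=
  [set t | is_standard t].

Definition num_SYT (s : seq nat) : nat := #|SYT s|.

(* Each part of a partition of n is at most n, so 'I_n.+1 loses no triple. *)
Definition parts (n : nat) (l : 3.-tuple 'I_n.+1) : seq nat := map val l.

Definition X0 (n k : nat) : {set 3.-tuple 'I_n.+1} :=
  [set l | [&& is_partition_of n (parts l), nth 0 (parts l) 1 == k
             & k == nth 0 (parts l) 2 %[mod 2]]].

Definition X1 (n k : nat) : {set 3.-tuple 'I_n.+1} :=
  [set l | [&& is_partition_of n (parts l), nth 0 (parts l) 1 == k
             & k != nth 0 (parts l) 2 %[mod 2]]].

Definition ceil_div (m d : nat) : nat := (m + d.-1) %/ d.

(* Main.v *)
Require Import Defs.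
From mathcomp Require Import all_boot all_algebra.
From mathcomp Require Import zify ring lra.

(* Write X_e(n,k) for the sum of f^(n-k-c,k,c) over c with k + c of parity e, and
   put h(n,k) = f^(k,k,1^(n-2k)), P(n,k) = h(n,k) + h(n,k+1) and
   Q(n,k) = f^(k+1,k,1^(n-2k-1)).  Removing corners gives
     P(n+1,k) = P(n,k) + Q(n,k) + Q(n,k-1),
     X_e(n+1,k) = X_e(n,k) + X_~e(n,k) + X_~e(n,k-1) - (defects),
   where the defects are the shapes to which the missing box cannot be added:
   (n-2k,k,k) in the third row, (k-1,k-1,n+2-2k) in the second.  At most one of the
   two exists, and their three-row product formulas continue each other, so a single
   closed form covers both; the hook length formula then gives
     Q(n+1,k) + (defects) = P(n,k) + Q(n,k) + P(n,k-1).
   Induction on n identifies {X_0, X_1} with {P, Q}.  The position of the defect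
   decides which is which, and the switch of roles is consistent because P = Q on
   the line n = 3k-1. *)

Set Implicit Arguments.
Unset Strict Implicit.
Unset Printing Implicit Defensive.

Import GRing.Theory Num.Theory.

(** * Branching rule *)

Section Linear.
Variables (M : nat) (T : finType) (lt : rel T).
Implicit Types (D : {set T}) (g : {ffun T -> 'I_M.+1}).

(* Fillings are 0 outside [D], so that each filling of [D] is counted once. *)
Definition lin D : {set {ffun T -> 'I_M.+1}} :=
  [set g : {ffun T -> 'I_M.+1} | [&& [forall x, (x \notin D) ==> (g x == ord0)],
               [forall x in D, g x < #|D|],
               [forall x in D, forall y in D, (g x == g y) ==> (x == y)]
             & [forall x in D, forall y in D, lt x y ==> (g x < g y)]]].

Lemma linP D g :
  reflect [/\ forall x, x \notin D -> g x = ord0,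
              forall x, x \in D -> g x < #|D|,
              {in D &, injective g}
            & {in D &, forall x y, lt x y -> g x < g y}] (g \in lin D).
Proof.
rewrite inE; apply: (iffP and4P) => [[H1 H2 H3 H4] | [H1 H2 H3 H4]]; split.
- by move=> x xD; move/forallP/(_ x): H1; rewrite xD => /eqP.
- by move=> x xD; move/forall_inP: H2; apply.
- move=> x y xD yD E; move/forall_inP/(_ x xD)/forall_inP/(_ y yD): H3.
  by rewrite E eqxx => /eqP.
- by move=> x y xD yD E; move/forall_inP/(_ x xD)/forall_inP/(_ y yD)/implyP: H4; apply.
- by apply/forallP=> x; apply/implyP=> xD; apply/eqP/H1.
- by apply/forall_inP.
- apply/forall_inP=> x xD; apply/forall_inP=> y yD; apply/implyP=> /eqP E.
  by apply/eqP/H3.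
- by apply/forall_inP=> x xD; apply/forall_inP=> y yD; apply/implyP; apply: H4.
Qed.

Definition maximal_in D x := [forall y in D, ~~ lt x y].

(** Erasing the top value m at x gives a filling of the smaller set, since injectivity keeps the
    other values below m. Conversely [ext] writes m at x: nothing in D lies above the maximal x, so
    monotonicity survives. *)
Lemma card_lin_top D m x : #|D| = m.+1 -> m <= M -> x \in D -> maximal_in D x ->
  #|[set g in lin D | g x == m :> nat]| = #|lin (D :\ x)|.
Proof.
move=> cD mM xD mx.
have cD' : #|D :\ x| = m by move: (cardsD1 x D); rewrite xD cD => -[].
pose ext g : {ffun T -> 'I_M.+1} := [ffun y => if y == x then inord m else g y].
rewrite -(@card_in_imset _ _ ext (lin (D :\ x))); last first.
  move=> g1 g2 /linP[g10 _ _ _] /linP[g20 _ _ _] /ffunP E; apply/ffunP=> y.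
  have := E y; rewrite !ffunE; case: eqVneq => // -> _.
  by rewrite g10 ?g20 // !inE eqxx.
apply: eq_card => g; rewrite inE; apply/andP/imsetP => [[/linP[g0 gl gi gm] /eqP gx]|].
  exists [ffun y => if y == x then ord0 else g y]; last first.
    apply/ffunP=> y; rewrite !ffunE; case: eqVneq => // ->.
    by apply: val_inj; rewrite /= inordK ?ltnS.
  apply/linP; split.
  - by move=> y; rewrite !inE ffunE; case: eqVneq => //= _; apply: g0.
  - move=> y; rewrite !inE ffunE => /andP[yx yD]; rewrite (negbTE yx) cD'.
    move: (gl _ yD); rewrite cD ltnS leq_eqVlt => /orP[/eqP E|//].
    case/eqP: yx; apply: gi => //; apply: val_inj; rewrite /= gx; exact: E.
  - move=> y z; rewrite !inE !ffunE => /andP[/negbTE-> yD] /andP[/negbTE-> zD].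
    exact: gi.
  - move=> y z; rewrite !inE !ffunE => /andP[/negbTE-> yD] /andP[/negbTE-> zD].
    exact: gm.
case=> g' /linP[g0 gl gi gm] ->; rewrite ffunE eqxx inordK ?ltnS //; split=> //.
have gl' y : y != x -> y \in D -> g' y < m.
  by move=> yx yD; rewrite -cD' gl // !inE yx.
apply/linP; split.
- move=> y yD; rewrite ffunE; case: eqVneq => [E|_].
    by rewrite E xD in yD.
  by apply: g0; rewrite !inE (negbTE yD) andbF.
- move=> y yD; rewrite ffunE cD; case: eqVneq => [E|yx]; first by rewrite inordK.
  by apply: leqW; apply: gl'.
- move=> y z yD zD; rewrite !ffunE; case: eqVneq => [->|yx]; case: eqVneq => [->|zx] //.
  + by move=> /(congr1 val)/= E; move: (gl' z zx zD); rewrite -E inordK ?ltnS ?ltnn.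
  + by move=> /(congr1 val)/= E; move: (gl' y yx yD); rewrite E inordK ?ltnS ?ltnn.
  + by apply: gi; rewrite !inE ?yx ?zx.
- move=> y z yD zD; rewrite !ffunE; case: eqVneq => [->|yx].
    by move=> L; move/forall_inP/(_ z zD): mx; rewrite L.
  case: eqVneq => [->|zx] L; first by rewrite inordK ?ltnS // gl'.
  by apply: gm; rewrite // !inE ?yx ?zx.
Qed.

(** Fillings are sorted by the point carrying the largest value, which is unique by injectivity and
    maximal by monotonicity. *)
Lemma card_lin D : 0 < #|D| <= M.+1 ->
  #|lin D| = \sum_(x in D | maximal_in D x) #|lin (D :\ x)|.
Proof.
case cD: #|D| => [//|m]; rewrite ltnS /= => mM.
under eq_bigr => x /andP[xD mx] do rewrite -(card_lin_top cD mM xD mx) -sum1_card.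
rewrite -sum1_card; under [RHS]eq_bigr => x _.
  rewrite (eq_bigl (fun g => (g \in lin D) && (g x == m :> nat))); last first.
    by move=> g; rewrite inE.
  rewrite big_mkcondr; over.
rewrite exchange_big /=; apply: eq_bigr => g /linP[g0 gl gi gm].
have gl' x : x \in D -> g x <= m by move/gl; rewrite cD ltnS.
have [x xD gx] : exists2 x, x \in D & g x = m :> nat.
  (* The m + 1 distinct values below m + 1 exhaust that range, so m is attained. *)
  have : (inord m : 'I_M.+1) \in g @: D.
    have sub : g @: D \subset [set i : 'I_M.+1 | i < m.+1].
      by apply/subsetP=> _ /imsetP[y yD ->]; rewrite inE ltnS gl'.
    have cS : #|[set i : 'I_M.+1 | i < m.+1]| <= m.+1.
      rewrite cardsE cardE -(size_map val) -[X in _ <= X](size_iota 0).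
      apply: uniq_leq_size; first by rewrite map_inj_uniq ?enum_uniq //; apply: val_inj.
      by move=> _ /mapP[i + ->]; rewrite mem_enum mem_iota.
    have /eqP -> : g @: D == [set i : 'I_M.+1 | i < m.+1].
      by rewrite eqEcard sub card_in_imset // cD.
    by rewrite inE inordK ?ltnS.
  by case/imsetP=> y yD E; exists y; rewrite // -E inordK ?ltnS.
rewrite (bigD1 x) /=; last first.
  rewrite xD; apply/forall_inP=> y yD; apply/negP=> /(gm _ _ xD yD).
  by rewrite gx ltnNge gl'.
rewrite gx eqxx big1 // => y /andP[/andP[yD _] yx].
case: eqP => // E; case/eqP: yx; apply: gi => //.
by apply: val_inj; rewrite /= gx.
Qed.

Lemma card_lin0 : #|lin set0| = 1.
Proof.
rewrite (_ : lin set0 = [set [ffun=> ord0]]) ?cards1 //.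
apply/setP=> g; rewrite in_set1; apply/linP/eqP => [[g0 _ _ _]|->].
  by apply/ffunP=> x; rewrite ffunE g0 ?inE.
by split=> [x _|x|x y|x y]; rewrite ?ffunE ?inE.
Qed.
End Linear.

(** * Standard tableaux as fillings of a diagram in a fixed grid *)

Section Diagram.
Variables (r C : nat).

Definition diagram (s : seq nat) : {set 'I_r * 'I_C} :=
  [set y : 'I_r * 'I_C | y.2 < nth 0 s y.1].

(** Only cells of one row or one column are compared, as in [is_standard]; [lin] does not ask for a
    transitive relation. *)
Definition cell_lt : rel ('I_r * 'I_C) := fun x y =>
  (x.1 == y.1) && (x.2 < y.2) || (x.2 == y.2) && (x.1 < y.1).

End Diagram.

Lemma cell_eq (s : seq nat) (x y : cell s) :
  cell_row x = cell_row y -> cell_col x = cell_col y -> x = y.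
Proof.
case: x y => [i u] [j v]; rewrite /cell_row /cell_col /= => /val_inj ij.
by case: j / ij v => v /val_inj ->.
Qed.

(** The types of [cell s] and of its fillings depend on s. A common r by C grid and a common bound M
    place a shape and its subshapes in one type, where [card_lin] applies. *)
Lemma num_SYT_lin (s : seq nat) (r C M : nat) :
  size s = r -> (forall i, nth 0 s i <= C) -> sumn s <= M.+1 ->
  num_SYT s = #|lin M (@cell_lt r C) (diagram r C s)| /\
  #|diagram r C s| = sumn s.
Proof.
move=> Er; subst r => sC sM.
pose emb (x : cell s) : 'I_(size s) * 'I_C :=
  (tag x, widen_ord (sC (tag x)) (tagged x)).
have row_emb x : (emb x).1 = cell_row x :> nat by [].
have col_emb x : (emb x).2 = cell_col x :> nat by [].
have emb_inj : injective emb.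
  by move=> x y E; apply: cell_eq; rewrite -?row_emb -?col_emb E.
have emb_diag x : emb x \in diagram (size s) C s by rewrite inE /=; apply: ltn_ord.
have diag_emb y : y \in diagram (size s) C s -> exists x, emb x = y.
  rewrite inE => yD; exists (@Tagged _ y.1 (fun i : 'I_(size s) => 'I_(nth 0 s i)) (Ordinal yD)).
  by case: y yD => [i j] /= yD; congr pair; apply: val_inj.
have embD : diagram (size s) C s = emb @: setT.
  apply/setP=> y; apply/idP/imsetP => [/diag_emb[x <-]|[x _ ->]]; last exact: emb_diag.
  by exists x; rewrite ?inE.
have cD : #|diagram (size s) C s| = sumn s by rewrite embD card_imset // cardsT card_cell.
split=> //.
have lt_emb x y : cell_lt (emb x) (emb y) =
    (cell_row x == cell_row y) && (cell_col x < cell_col y)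
    || (cell_col x == cell_col y) && (cell_row x < cell_row y) by [].
have sM' (t : {ffun cell s -> 'I_(sumn s)}) x : t x < M.+1 by apply: leq_trans sM.
pose F (t : {ffun cell s -> 'I_(sumn s)}) : {ffun 'I_(size s) * 'I_C -> 'I_M.+1} :=
  [ffun y => if [pick x | emb x == y] is Some x then inord (t x) else ord0].
have F_emb t x : F t (emb x) = t x :> nat.
  rewrite ffunE; case: pickP => [z /eqP/emb_inj->|/(_ x)]; last by rewrite eqxx.
  by rewrite inordK.
have F0 t y : y \notin diagram (size s) C s -> F t y = ord0.
  move=> yD; rewrite ffunE; case: pickP => // x /eqP E.
  by case/negP: yD; rewrite -E emb_diag.
rewrite /num_SYT -(@card_in_imset _ _ F); last first.
  move=> t1 t2 _ _ E; apply/ffunP=> x; apply: val_inj.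
  by rewrite /= -!F_emb E.
apply: eq_card => g; apply/imsetP/idP => [[t]|].
  rewrite inE => /and3P[/injectiveP ti /forallP tr /forallP tc] ->.
  apply/linP; split.
  - exact: F0.
  - by move=> _ /diag_emb[x <-]; rewrite F_emb cD.
  - move=> _ _ /diag_emb[x <-] /diag_emb[y <-] /(congr1 val) /=.
    by rewrite !F_emb => /val_inj/ti->.
  - move=> _ _ /diag_emb[x <-] /diag_emb[y <-]; rewrite !F_emb lt_emb.
    case/orP => E; first by move/forallP/(_ y): (tr x); rewrite E.
    by move/forallP/(_ y): (tc x); rewrite E.
case/linP=> g0 gl gi gm.
have gl' x : g (emb x) < sumn s by rewrite -cD gl.
pose t : {ffun cell s -> 'I_(sumn s)} := [ffun x => Ordinal (gl' x)].
exists t; last first.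
  apply/ffunP=> y; case yD: (y \in diagram (size s) C s); last first.
    by rewrite F0 ?g0 ?yD.
  by case/diag_emb: yD => x <-; apply: val_inj; rewrite /= F_emb ffunE.
rewrite inE; apply/and3P; split.
- apply/injectiveP=> x y; rewrite !ffunE => /(congr1 val) /= E; apply: emb_inj.
  by apply: gi => //; apply: val_inj.
- apply/forallP=> x; apply/forallP=> y; apply/implyP=> E; rewrite !ffunE /=.
  by apply: gm => //; rewrite lt_emb E.
- apply/forallP=> x; apply/forallP=> y; apply/implyP=> E; rewrite !ffunE /=.
  by apply: gm => //; rewrite lt_emb E orbT.
Qed.

Lemma leq_nth_sumn (s : seq nat) i : nth 0 s i <= sumn s.
Proof.
elim: s i => [|x s IH] [|i] //=; first exact: leq_addr.
by apply: (leq_trans (IH i)); apply: leq_addl.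
Qed.

Lemma num_SYT_sum0 (s : seq nat) : sumn s = 0 -> num_SYT s = 1.
Proof.
move=> s0; have ns i : nth 0 s i <= 0 by have := leq_nth_sumn s i; rewrite s0.
have [|-> c0] := @num_SYT_lin s _ 0 0 erefl ns; first by rewrite s0.
suff -> : diagram (size s) 0 s = set0 by rewrite card_lin0.
by apply/eqP; rewrite -cards_eq0 c0 s0.
Qed.

Definition dec_nth (s : seq nat) i := set_nth 0 s i (nth 0 s i).-1.

Lemma size_dec_nth s i : i < size s -> size (dec_nth s i) = size s.
Proof. by move=> si; rewrite size_set_nth; apply/maxn_idPr. Qed.

Lemma sumn_dec_nth s i : nth 0 s i > 0 -> (sumn (dec_nth s i)).+1 = sumn s.
Proof.
rewrite /dec_nth; elim: s i => [|x s IH] [|i] //=; first by case: x.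
by move=> /IH <-; rewrite addnS.
Qed.

(* The entry [sumn s - 1] of a standard tableau sits in a removable corner, and
   deleting that corner is a bijection onto the tableaux of the smaller shape. *)
Lemma num_SYT_branch (s : seq nat) : sorted geq s -> 0 < sumn s ->
  num_SYT s = \sum_(i < size s | nth 0 s i.+1 < nth 0 s i) num_SYT (dec_nth s i).
Proof.
move=> ss s0; pose r := size s; pose C := sumn s; pose M := sumn s.
have nC i : nth 0 s i <= C by apply: leq_nth_sumn.
have nn i j : i <= j -> nth 0 s j <= nth 0 s i.
  move=> ij; case: (ltnP j (size s)) => sj; last by rewrite (nth_default _ sj).
  have geq_trans : transitive geq by move=> x y z /= yx zy; apply: leq_trans yx.
  apply: (sorted_leq_nth geq_trans _ 0 ss) => //; first exact: leqnn.
  by rewrite inE; apply: leq_ltn_trans sj.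
have [-> cD] := @num_SYT_lin s r C M erefl nC (leqnSn _).
rewrite card_lin ?cD ?s0 ?leqnSn //.
have C0 : 0 < C by [].
have [C' eC] : exists C', C = C'.+1 by exists C.-1; rewrite prednK.
(* The last cell of row i. For an empty row this is column 0, which lies outside the diagram and so
   contributes nothing. *)
pose corner (i : 'I_r) : 'I_r * 'I_C := (i, cast_ord (esym eC) (inord (nth 0 s i).-1)).
have cornerE i : (corner i).2 = (nth 0 s i).-1 :> nat.
  rewrite /= inordK // -eC; have := nC i; lia.
rewrite (reindex_onto corner fst); last first.
  move=> [i j]; rewrite inE /= => /andP[ij /forall_inP mx]; congr pair.
  apply: val_inj; rewrite [LHS](cornerE i).
  apply/eqP; rewrite eq_sym eqn_leq; apply/andP; split.
    by rewrite -ltnS prednK //; apply: leq_ltn_trans ij.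
  rewrite leqNgt; apply/negP=> jl.
  have := mx (corner i); rewrite inE cornerE /cell_lt cornerE /= eqxx jl.
  suff -> : (nth 0 s i).-1 < nth 0 s i by move/(_ isT).
  by rewrite prednK //; apply: leq_ltn_trans ij.
apply: eq_big => [i|i].
  rewrite eqxx andbT inE cornerE /=; apply/andP/idP => [[p /forall_inP mx]|lt].
    rewrite ltnNge; apply/negP=> le.
    have [iS|iS] := ltnP i.+1 r; last first.
      by move: le p; rewrite (nth_default _ iS) leqn0 => /eqP->.
    have := mx (Ordinal iS, (corner i).2); rewrite inE cornerE /cell_lt cornerE /=.
    by rewrite eqxx ltnSn orbT => /(_ (leq_trans p le)).
  have si : 0 < nth 0 s i by apply: leq_ltn_trans lt.
  split; first by rewrite prednK.
  apply/forall_inP=> -[i' j']; rewrite inE /cell_lt cornerE /= => lt'.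
  apply/negP=> /orP[/andP[/eqP E H]|/andP[/eqP E H]].
    by subst i'; move: (leq_ltn_trans H lt'); rewrite prednK // ltnn.
  move/(congr1 val): E; rewrite [X in X = _ -> _]cornerE /= => E.
  move: (leq_ltn_trans (nn _ _ H) lt); rewrite ltnNge.
  by move: (leq_trans lt' (nn _ _ (leqnn _))); rewrite -E prednK // => ->.

rewrite eqxx andbT => /andP[]; rewrite inE cornerE /= => p _.
have si : 0 < nth 0 s i by apply: leq_ltn_trans p.
have [||-> _] := @num_SYT_lin (dec_nth s i) r C M (size_dec_nth (ltn_ord i)).
- move=> j; rewrite nth_set_nth /=; case: eqP => [_|_]; last exact: nC.
  by apply: leq_trans (nC i); apply: leq_pred.
- by apply: leqW; rewrite -ltnS sumn_dec_nth.
congr #|pred_of_set (lin _ _ _)|; apply/setP=> -[a b].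
rewrite !inE nth_set_nth /= xpair_eqE.
have -> : (b == (corner i).2) = (b == (nth 0 s i).-1 :> nat).
  by rewrite -cornerE.
have -> : (a == i) = (a == i :> nat) by [].
case: eqP => [->|//] /=; lia.
Qed.

(** * Product formulas for [(a, b, c)] and [(a, b, 1^m)] *)

Lemma num_SYT3_branch a b c : c <= b <= a -> 0 < a ->
  num_SYT [:: a; b; c] =
    (if b < a then num_SYT [:: a.-1; b; c] else 0)
    + (if c < b then num_SYT [:: a; b.-1; c] else 0)
    + (if 0 < c then num_SYT [:: a; b; c.-1] else 0).
Proof.
move=> /andP[cb ba] a0; rewrite num_SYT_branch /= ?cb ?ba ?addn_gt0 ?a0 //.
by rewrite big_mkcond !big_ord_recl big_ord0 /dec_nth /= addn0 addnA.
Qed.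

(** The hook length formula for three rows with cleared denominators, by induction on the size
    through the branching rule. *)
Lemma num_SYT3 a b c : c <= b <= a ->
  ((num_SYT [:: a; b; c])%:R * (a.+2`! * b.+1`! * c`!)%:R
   = (a + b + c)`!%:R * (a%:R - b%:R + 1) * (a%:R - c%:R + 2) * (b%:R - c%:R + 1)
   :> rat)%R.
Proof.
elim: {a b c}(a + b + c) {-2}a {-2}b {-2}c (erefl (a + b + c)) => [|n IH] a b c E le.
  have [-> [-> ->]] : a = 0 /\ b = 0 /\ c = 0 by lia.
  by rewrite num_SYT_sum0.
have a0 : 0 < a by lia.
rewrite num_SYT3_branch // E 2!natrD 2!mulrDl.
(* Each corner contributes n! times a polynomial that vanishes when the corner is not removable,
   through the factor a - b here and b - c, c below. The three contributions then add up by a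
   polynomial identity. *)
have -> : ((if (b < a)%N then num_SYT [:: a.-1; b; c] else 0)%:R * (a.+2`! * b.+1`! * c`!)%:R
  = n`!%:R * a.+2%:R * (a%:R - b%:R) * (a%:R - c%:R + 1) * (b%:R - c%:R + 1) :> rat)%R.
  case: (ltnP b a) => ba; last first.
    have -> : a = b by lia.
    by rewrite subrr !(mulr0, mul0r).
  case: a E le a0 ba => // a E le _ ba.
  have := IH a b c; rewrite (_ : a + b + c = n); last lia.
  move=> /(_ erefl); rewrite (_ : c <= b <= a); last lia.
  move=> /(_ isT) H.
  rewrite (_ : _ * _ * _ = a.+3 * (a.+2`! * b.+1`! * c`!))%N; last first.
    by rewrite factS !mulnA.
  rewrite natrM mulrCA H.
  rewrite -!natr1; ring.
have -> : ((if (c < b)%N then num_SYT [:: a; b.-1; c] else 0)%:R * (a.+2`! * b.+1`! * c`!)%:R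
  = n`!%:R * b.+1%:R * (a%:R - b%:R + 2) * (a%:R - c%:R + 2) * (b%:R - c%:R) :> rat)%R.
  case: (ltnP c b) => cb; last first.
    have -> : b = c by lia.
    by rewrite subrr !(mulr0, mul0r).
  case: b E le cb => // b E le cb.
  have := IH a b c; rewrite (_ : a + b + c = n); last lia.
  move=> /(_ erefl); rewrite (_ : c <= b <= a); last lia.
  move=> /(_ isT) H; rewrite (_ : _ * _ * _ = b.+2 * (a.+2`! * b.+1`! * c`!))%N; last first.
    by rewrite [b.+2`!]factS (mulnCA _ b.+2) !mulnA.
  rewrite natrM mulrCA H.
  rewrite -!natr1; ring.
have -> : ((if (0 < c)%N then num_SYT [:: a; b; c.-1] else 0)%:R * (a.+2`! * b.+1`! * c`!)%:R
  = n`!%:R * c%:R * (a%:R - b%:R + 1) * (a%:R - c%:R + 3) * (b%:R - c%:R + 2) :> rat)%R.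
  case: c E le => [|c] E le /=; first by rewrite !(mulr0, mul0r).
  have := IH a b c; rewrite (_ : a + b + c = n); last lia.
  move=> /(_ erefl); rewrite (_ : c <= b <= a); last lia.
  move=> /(_ isT) H; rewrite [c.+1`!]factS (mulnCA _ c.+1) natrM mulrCA H.
  rewrite -!natr1; ring.
have -> : (n.+1`!%:R = n`!%:R * (a%:R + b%:R + c%:R) :> rat)%R.
  by rewrite factS natrM mulrC -E !natrD.
rewrite -!natr1; ring.
Qed.

(* The [p] empty rows keep this family closed under [dec_nth]. *)
Definition hook2 a b m p := num_SYT ([:: a; b] ++ nseq m 1 ++ nseq p 0).

Lemma hook2_branch a b m p : (0 < m) <= b <= a -> 0 < a ->
  hook2 a b m p =
    (if b < a then hook2 a.-1 b m p else 0)
    + (if (0 < m) < b then hook2 a b.-1 m p else 0)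
    + (if 0 < m then hook2 a b m.-1 p.+1 else 0).
Proof.
move=> /andP[mb ba] a0; rewrite /hook2.
have sort_tail x : (0 < m) <= x -> path geq x (nseq m 1 ++ nseq p 0).
  have z y : path geq y (nseq p 0) by elim: p y => //= p IH y; rewrite leq0n IH.
  clear mb; elim: m x => [|m IH] x /=; first by move=> _; apply: z.
  by move=> ->; rewrite IH //; case: m {IH}.
rewrite num_SYT_branch /= ?ba ?sort_tail ?addn_gt0 ?a0 //.
set w := nseq m 1 ++ nseq p 0.
have nw i : nth 0 w i = (i < m).
  rewrite nth_cat size_nseq !nth_nseq; case: ltnP => // _; by case: ifP.
rewrite big_mkcond !big_ord_recl /= /bump /= ?add1n /dec_nth /= -addnA.
congr addn; congr addn; first by rewrite nw.
have sw : size w = m + p by rewrite size_cat !size_nseq.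
clearbody w.
case: m w nw sw {mb sort_tail} => [|m] w nw sw.
  by rewrite big1 // => i _; rewrite /bump /= ?add0n ?add1n /= !nw.
have im : m < size w by lia.
(* Within the column only the last box is removable; its row becomes one more empty row. *)
rewrite (bigD1 (Ordinal im)) //= big1 => [|i ni].
  rewrite /bump /= ?add0n ?add1n /= !nw ltnn ltnSn /= addn0; congr num_SYT.
  congr [:: _, _ & _]; apply: (@eq_from_nth _ 0).
    by rewrite size_set_nth sw !size_cat /= !size_nseq; lia.
  move=> i _; rewrite nth_set_nth /= nw nth_cat !size_nseq.
  rewrite -[0 :: nseq p 0]/(nseq p.+1 0) !nth_nseq.
  by case: (ltngtP i m) => [h|h|->] /=; rewrite ?ltnS ?(ltnW h) ?subnn ?if_same // leqNgt h.
rewrite /bump /= ?add0n ?add1n /= !nw; case: ifP => // E.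
by case/eqP: ni; apply: val_inj => /=; lia.
Qed.

Lemma hook2_row a p : hook2 a 0 0 p = 1.
Proof.
have z : sumn (nseq p 0) = 0 by rewrite sumn_nseq.
elim: a => [|a IH]; first by rewrite /hook2 num_SYT_sum0 /=.
by rewrite hook2_branch //= IH.
Qed.

(* The hook length formula for the shape [(a, b + 1, 1^m)]. *)
Definition hook2_formula (a b m : nat) : rat :=
  ((a + b.+1 + m)`!%:R * (a%:R - b%:R) /
   ((a + m + 1)%:R * (b + m + 1)%:R * m`!%:R * a`!%:R * b`!%:R))%R.

Lemma natr_fact_neq0 n : (n`!%:R != 0 :> rat)%R.
Proof. by rewrite pnatr_eq0 -lt0n fact_gt0. Qed.

Ltac natr_field :=
  field; repeat (apply/andP; split) => //; apply: lt0r_neq0; lra.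

(** Induction on the size through the branching rule. The formula vanishes at a = b, which covers a
    first row without removable box; a second row of length one leaves the range of the formula and
    is treated apart. *)
Lemma hook2E a b m p : b < a -> ((hook2 a b.+1 m p)%:R = hook2_formula a b m)%R.
Proof.
elim: {a b m}(a + b + m) {-2}a {-2}b {-2}m p (erefl (a + b + m)) => [|n IH] a b m p E lt.
  lia.
case: a E lt => // a E lt.
rewrite hook2_branch //; last by case: (m).
rewrite !natrD /=.
have p0 := ler0n rat.
have F x := natr_fact_neq0 x.
have -> : ((if (b.+1 < a.+1)%N then hook2 a b.+1 m p else 0)%:R = hook2_formula a b m)%R.
  case: ifP => H; first by apply: IH; lia.
  have -> : a = b by lia.
  by rewrite /hook2_formula subrr mulr0 mul0r.
case: m E => [|m] E /=.
  rewrite /= addr0; case: b E lt => [|b] E lt /=.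
    rewrite hook2_row /hook2_formula.
    rewrite !addn0 !addn1 !factS !natrM -!natr1 ?add0r.
    have := p0 a; move=> *; natr_field.
  rewrite IH; try lia.
  rewrite /hook2_formula !(addn0, addSn, addnS, addn1) !factS !natrM -!natr1 !natrD.
  have := p0 a; have := p0 b; move=> *; natr_field.
rewrite (IH _ _ m); try lia.
case: b E lt => [|b] E lt /=.
  rewrite addr0.
  rewrite /hook2_formula !(addn0, addSn, addnS, addn1) !factS !natrM -!natr1 !natrD.
  have := p0 a; have := p0 m; move=> *; natr_field.
rewrite (IH _ _ m.+1); try lia.
rewrite /hook2_formula !(addn0, addSn, addnS, addn1) !factS !natrM -!natr1 !natrD.
have := p0 a; have := p0 b; have := p0 m; move=> *; natr_field.
Qed.

Lemma hook2_pad a b m p : 0 < b <= a -> hook2 a b m p = hook2 a b m 0.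
Proof.
case: b => // b ba; apply/eqP; rewrite -(eqr_nat rat).
by rewrite !hook2E.
Qed.

(** * Recursions for the two sides *)

Definition row3 n k c :=
  if (c <= k) && (2 * k + c <= n) then num_SYT [:: n - k - c; k; c] else 0.

(** The right side removes a box from row one, two or three. Its terms without a counterpart on the
    left are (n-2k-2, k+1, k+1), met at c = k + 2, and (k, k, c), met at c + 2k = n; they are the
    two corrections. *)
Lemma row3_rec n k c :
  row3 n.+1 k.+1 c + (if c == k.+2 then row3 n k.+1 k.+1 else 0)
  + (if c + 2 * k == n then row3 n k c else 0)
  = row3 n k.+1 c + row3 n k c + (if 0 < c then row3 n k.+1 c.-1 else 0).
Proof.
have [ck|kc] := leqP c k.+1; last first.
  have z n' : row3 n' k.+1 c = 0 by rewrite /row3 ifF //; lia.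
  have -> : row3 n k c = 0 by rewrite /row3 ifF //; lia.
  rewrite !z if_same add0n addn0 /=; case: eqP => [->//|ne].
  have -> : row3 n k.+1 c.-1 = 0 by rewrite /row3 ifF //; lia.
  by rewrite if_same.
rewrite [c == _]ltn_eqF ?ltnS // addn0.
have [le|gt] := leqP (2 * k.+1 + c) n.+1; last first.
  have -> : row3 n.+1 k.+1 c = 0 by rewrite /row3 ifF //; lia.
  have -> : row3 n k.+1 c = 0 by rewrite /row3 ifF //; lia.
  have -> : row3 n k.+1 c.-1 = 0 by rewrite /row3 ifF //; lia.
  rewrite if_same addn0 !add0n; case: eqP => // ne.
  by rewrite /row3 ifF //; lia.
rewrite [_ == n]ltn_eqF; last lia.
rewrite addn0 {1}/row3 ck le /= num_SYT3_branch; try lia.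
congr (_ + _ + _).
- rewrite /row3 ck /=; case: ifP => H; case: ifP => H' //; try lia.
  by congr (num_SYT [:: _; _; _]); lia.
- by rewrite /row3; case: ifP => H; case: ifP => H' //; lia.
- rewrite /row3; case: ifP => // H; rewrite ifT; last lia.
  by congr (num_SYT [:: _; _; _]); lia.
Qed.

(** The class [e = false] stands for [X0], [e = true] for [X1]. *)
Definition row3_sum n k e := \sum_(c < k.+1 | odd (k + c) == e) row3 n k c.

(** A range independent of k lets sums for different k be added term by term. *)
Lemma row3_sumE n k e B : k < B ->
  row3_sum n k e = \sum_(0 <= c < B) if odd (k + c) == e then row3 n k c else 0.
Proof.
move=> kB; rewrite /row3_sum big_mkcond big_mkord.
rewrite [LHS](big_ord_widen B (fun c => if odd (k + c) == e then row3 n k c else 0)) //.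
rewrite [LHS]big_mkcond; apply: eq_bigr => c _; case: ifP => // ck.
by rewrite /row3 -[c <= k]ltnS ck if_same.
Qed.

Lemma sum_delta B x (F : nat -> nat) : x < B ->
  \sum_(0 <= c < B) (if c == x then F c else 0) = F x.
Proof.
by move=> xB; rewrite big_mkord -big_mkcond (big_pred1 (Ordinal xB)).
Qed.

(* (n - 2k - 2, k + 1, k + 1) admits no further box in row three, and (k, k, n - 2k) none
   in row two; both defects are 0 when these triples are not partitions. *)
Definition third_row_defect n k := row3 n k.+1 k.+1.
Definition second_row_defect n k := row3 n k (n - 2 * k).

(** [row3_rec] summed over one parity class. Removing a box from row two or three flips the class,
    whence [~~ e]. The defects sit at c = k + 2 and c = n - 2k, where k + 1 + c is odd, respectively
    of parity opposite to n + k. *)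
Lemma row3_sum_rec n k e : 2 * k <= n ->
  row3_sum n.+1 k.+1 e + (if e then third_row_defect n k else 0)
  + (if odd (n + k) != e then second_row_defect n k else 0)
  = row3_sum n k.+1 e + row3_sum n k (~~ e) + row3_sum n k.+1 (~~ e).
Proof.
move=> kn; pose B := n + k + 3.
rewrite (@row3_sumE _ _ _ B.+1) ?(@row3_sumE n k.+1 e B.+1) ?(@row3_sumE n k _ B.+1);
  try by rewrite /B; lia.
rewrite (@row3_sumE _ _ _ B); last by rewrite /B; lia.
have -> : (if e then third_row_defect n k else 0) = \sum_(0 <= c < B.+1)
    if c == k.+2 then if odd (k.+1 + c) == e then row3 n k.+1 k.+1 else 0 else 0.
  rewrite sum_delta; last by rewrite /B; lia.
  by rewrite (_ : odd _ = true); last lia.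
have -> : (if odd (n + k) != e then second_row_defect n k else 0)
    = \sum_(0 <= c < B.+1) if c == n - 2 * k then
        if odd (k.+1 + c) == e then row3 n k c else 0 else 0.
  rewrite sum_delta; last by rewrite /B; lia.
  by rewrite (_ : odd (k.+1 + _) = ~~ odd (n + k)); [case: odd; case: e | lia].
have -> : \sum_(0 <= c < B) (if odd (k.+1 + c) == ~~ e then row3 n k.+1 c else 0)
   = \sum_(0 <= c < B.+1) if odd (k.+1 + c) == e then
       if 0 < c then row3 n k.+1 c.-1 else 0 else 0.
  rewrite [RHS]big_nat_recl //= if_same add0n; apply: eq_bigr => c _.
  by rewrite addnS /=; case: odd; case: e.
rewrite -!big_split; apply: eq_bigr => c _ /=.
have -> : (odd (k + c) == ~~ e) = (odd (k.+1 + c) == e).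
  by rewrite addSn /=; case: odd; case: e.
case: ifP => _; last by rewrite !if_same.
rewrite -row3_rec (_ : (c == n - 2 * k) = (c + 2 * k == n)) //; lia.
Qed.

(** * Recursions for the shapes with two rows and a column *)

(** The value 0 at k = 0, here and in [hook_succ], extends the identities to k = 0, where the
    induction starts: for n > 1 they become f^(n) = f^(1,1,1^(n-2)) and 0 = 0. *)
Definition hook_eq n k :=
  if (0 < k) && (2 * k <= n) then num_SYT ([:: k; k] ++ nseq (n - 2 * k) 1) else 0.
Definition hook_succ n k :=
  if (0 < k) && (2 * k < n) then num_SYT ([:: k.+1; k] ++ nseq (n - 2 * k - 1) 1) else 0.

Lemma hook2_nseq a b m : num_SYT ([:: a; b] ++ nseq m 1) = hook2 a b m 0.
Proof. by rewrite /hook2 cats0. Qed.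

(** With two equal rows only the second row and the column can lose a box. At n = 1 the shape (1,1)
    would restrict to (1), which [hook_succ 1 0] counts as 0. *)
Lemma hook_eq_rec n k : 1 < n -> hook_eq n.+1 k.+1 = hook_eq n k.+1 + hook_succ n k.
Proof.
move=> n1; rewrite /hook_eq /hook_succ !hook2_nseq /=.
have [lt|] := ltnP n.+1 (2 * k.+1); first by rewrite !ifF //; lia.
rewrite leq_eqVlt => /orP[/eqP E|lt].
  rewrite ifF; last lia.
  rewrite ifT; last lia.
  rewrite -E subnn (_ : n - 2 * k - 1 = 0); last lia.
  by rewrite hook2_branch //= ltnn addn0.
have -> : n.+1 - 2 * k.+1 = (n - 2 * k.+1).+1 by lia.
rewrite ifT; last lia.
rewrite hook2_branch //= ltnn add0n hook2_pad //= addnC; congr addn.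
case: k lt => //= k lt; rewrite ifT; last lia.
by congr hook2; lia.
Qed.

Definition hook_pair n k := hook_eq n k + hook_eq n k.+1.

Lemma hook_pair_rec n k : 2 * k.+1 <= n ->
  hook_pair n.+1 k.+1 = hook_pair n k.+1 + hook_succ n k.+1 + hook_succ n k.
Proof. by move=> kn; rewrite /hook_pair !hook_eq_rec; lia. Qed.

(** Adding (2,1,0) to (m, k+1, k+1) and to (k, k, m+2) gives the same three numbers up to a cyclic
    permutation, so the two product formulas agree. When neither shape exists, m = k or m = k - 1,
    two of these numbers coincide and the formula is 0. *)
Lemma defectE k m : 0 < m ->
  let n := 2 * k.+1 + m in
  ((third_row_defect n k + second_row_defect n k)%:R
  = n`!%:R * (m%:R - k%:R) * (m%:R - k%:R + 1) / (m.+2`!%:R * k.+2`!%:R * k.+1`!%:R) :> rat)%R.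
Proof.
move=> m0 n.
have F := natr_fact_neq0.
have fne : (m.+2`!%:R * k.+2`!%:R * k.+1`!%:R != 0 :> rat)%R by rewrite !mulf_neq0.
apply: (mulIf fne); rewrite divfK //.
have -> : second_row_defect n k = if m.+2 <= k then num_SYT [:: k; k; m.+2] else 0.
  rewrite /second_row_defect /row3 (_ : n - 2 * k = m.+2); last lia.
  rewrite (_ : (2 * k + m.+2 <= n) = true) ?andbT; last lia.
  by rewrite (_ : n - k - m.+2 = k); last lia.
have -> : third_row_defect n k = if k < m then num_SYT [:: m; k.+1; k.+1] else 0.
  rewrite /third_row_defect /row3 leqnn /= (_ : (_ <= n) = (k < m)); last lia.
  by rewrite (_ : n - k.+1 - k.+1 = m); last lia.
have [km|mk] := ltnP k m.
  rewrite ifF ?addn0; last lia.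
  have := @num_SYT3 m k.+1 k.+1; rewrite leqnn km => /(_ isT).
  rewrite (_ : m + k.+1 + k.+1 = n) /n; last lia.
  rewrite !natrM !mulrA => ->; rewrite -!natr1; ring.
case: ifP => mk2.
  have := @num_SYT3 k k m.+2; rewrite leqnn mk2 => /(_ isT).
  rewrite (_ : k + k + m.+2 = n) /n; last lia.
  move=> H; rewrite add0n.
  rewrite (_ : (m.+2`!%:R * _ * _ = (k.+2`! * k.+1`! * m.+2`!)%:R)%R).
    by rewrite H -!natr1; ring.
  by rewrite !natrM; ring.
rewrite addn0 mul0r.
have [->|->] : m = k \/ k = m.+1 by lia.
  by rewrite subrr mulr0 mul0r.
by rewrite -natr1; ring.
Qed.

(** Keeping n as an atom gives all shapes of one size the same factor n!, which [field] can
    cancel. *)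
Lemma hook2E_size n a b m p : a + b.+1 + m = n -> b < a ->
  ((hook2 a b.+1 m p)%:R = n`!%:R * (a%:R - b%:R) /
   ((a%:R + m%:R + 1) * (b%:R + m%:R + 1) * m`!%:R * a`!%:R * b`!%:R) :> rat)%R.
Proof.
by move=> <- ba; rewrite hook2E // /hook2_formula !natrD.
Qed.

(** Branching at (k+2, k+1, 1^m) leaves an identity between shapes of size n: f^(k+2,k,1^m) plus the
    defects equals the sum of [hook_eq] at k, k + 1 and k + 2. It is checked on the closed forms. *)
Lemma hook_succ_rec k m : 0 < m ->
  let n := 2 * k.+1 + m in
  hook_succ n.+1 k.+1 + (third_row_defect n k + second_row_defect n k)
  = hook_pair n k.+1 + hook_succ n k.+1 + hook_pair n k.
Proof.
move=> m0 n; have En : n = 2 * k.+1 + m by []; clearbody n.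
have -> : hook_succ n.+1 k.+1 = hook_eq n k.+1
    + (if 0 < k then hook2 k.+2 k m 0 else 0) + hook_succ n k.+1.
  rewrite /hook_succ /hook_eq !hook2_nseq /=.
  have -> : 2 * k.+1 < n.+1 by lia.
  have -> : 2 * k.+1 <= n by lia.
  have -> : 2 * k.+1 < n by lia.
  have -> : n.+1 - 2 * k.+1 - 1 = m by lia.
  have -> : n - 2 * k.+1 = m by lia.
  rewrite hook2_branch ?m0 //= ltnSn; congr (_ + _ + _).
  by rewrite -subn1 hook2_pad; last lia.
suff H : (if 0 < k then hook2 k.+2 k m 0 else 0)
    + (third_row_defect n k + second_row_defect n k)
    = hook_eq n k.+2 + hook_eq n k.+1 + hook_eq n k.
  by rewrite /hook_pair; lia.
have Hd : ((third_row_defect n k + second_row_defect n k)%:R =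
    n`!%:R * (m%:R - k%:R) * (m%:R - k%:R + 1) / (m.+2`!%:R * k.+2`!%:R * k.+1`!%:R) :> rat)%R.
  by rewrite En defectE.
apply/eqP; rewrite -(eqr_nat rat) natrD Hd [X in _ == X]natrD [X in _ == (X + _)%R]natrD.
apply/eqP; clear Hd.
have -> : hook_eq n k.+1 = hook2 k.+1 k.+1 m 0.
  have le : 2 * k.+1 <= n by lia.
  by rewrite /hook_eq hook2_nseq le En addKn.
rewrite [((hook2 k.+1 k.+1 _ _)%:R)%R](@hook2E_size n) //; last lia.
have F := natr_fact_neq0; have k0 := ler0n rat k.
(* Writing 1/(m-2)! as m(m-1)/m! makes the formula give 0 at m = 1, where the shape does not
   exist. *)
have -> : ((hook_eq n k.+2)%:R = n`!%:R * m%:R * (m%:R - 1) /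
   ((k%:R + m%:R + 1) * (k%:R + m%:R) * m`!%:R * k.+2`!%:R * k.+1`!%:R) :> rat)%R.
  case: m m0 En => [//|[|m]] _ En; rewrite /hook_eq hook2_nseq.
    by rewrite ifF; [rewrite subrr mulr0 mul0r | lia].
  have -> : (0 < k.+2) && (2 * k.+2 <= n) by lia.
  have -> : n - 2 * k.+2 = m by lia.
  rewrite (@hook2E_size n) //; last lia.
  have m0 := ler0n rat m.
  rewrite [m.+2`!]factS [m.+1`!]factS !natrM -!natr1.
  natr_field.
have m1 : (1 <= m%:R :> rat)%R by rewrite ler1n.
case: k => [|k] in En k0 *.
  rewrite /hook_eq /= [m.+2`!]factS [m.+1`!]factS !factS fact0 !natrM -!natr1.
  natr_field.
have -> : hook_eq n k.+1 = hook2 k.+1 k.+1 m.+2 0.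
  have le : 2 * k.+1 <= n by lia.
  by rewrite /hook_eq hook2_nseq le /=; congr hook2; lia.
rewrite /= [((hook2 k.+3 _ _ _)%:R)%R](@hook2E_size n) //; try lia.
rewrite [((hook2 k.+1 _ _ _)%:R)%R](@hook2E_size n) //; last lia.
have {}k0 := ler0n rat k.
rewrite ![m.+2`!]factS ![m.+1`!]factS ![k.+3`!]factS ![k.+2`!]factS ![k.+1`!]factS !natrM -!natr1.
natr_field.
Qed.

(** The coincidence on the line n = 3K - 1, with K = k + 2, that permits the exchange of roles. *)
Lemma hook_pair_succ k : hook_pair (3 * k + 5) k.+2 = hook_succ (3 * k + 5) k.+2.
Proof.
have [n En] : exists n, n = 3 * k + 5 by exists (3 * k + 5).
rewrite -En /hook_pair /hook_succ /hook_eq !hook2_nseq /=.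
have -> : 2 * k.+2 <= n by lia.
have -> : 2 * k.+2 < n by lia.
have -> : n - 2 * k.+2 = k.+1 by lia.
rewrite subn1 /=; apply/eqP; rewrite -(eqr_nat rat) natrD.
rewrite ![in X in (X + _)%R](@hook2E_size n) ?[in X in _ == X](@hook2E_size n) //; try lia.
have F := natr_fact_neq0; have k0 := ler0n rat k; apply/eqP.
case: k => [|k] in En k0 *.
  rewrite ifF; last lia.
  rewrite !factS fact0.
  by field.
have -> : 2 * k.+4 <= n by lia.
have -> : n - 2 * k.+4 = k by lia.
rewrite [((hook2 k.+4 k.+4 _ _)%:R)%R](@hook2E_size n) //; try lia.
have {}k0 := ler0n rat k.
rewrite ![k.+4`!]factS ![k.+3`!]factS ![k.+2`!]factS ![k.+1`!]factS !natrM -!natr1.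
natr_field.
Qed.

(** * The induction on n and the parity classes *)

(** The bound n + 2 < 3k says that k exceeds the ceiling of n/3. The truth value also names the
    parity class whose sum is [hook_pair]. *)
Definition switched n k := odd (n + k) && (n + 2 < 3 * k).

Lemma hook_eq1 n : 1 < n -> hook_eq n 1 = 1.
Proof.
case: n => [//|[//|n]] _; elim: n => [|n IH].
  by rewrite /hook_eq /= (hook2_nseq 1 1 0) hook2_branch // !hook2_row.
by rewrite hook_eq_rec // IH.
Qed.

(** Induction on n, with k = 0 and n = 2k + 1 done directly. Otherwise [row3_sum_rec] reproduces the
    recursion of [hook_pair] in the class [switched] and that of [hook_succ] in the other, provided
    that no nonzero defect lies in the former. *)
Lemma row3_sumP n k : 2 * k < n -> 1 < n ->
  row3_sum n k (switched n k) = hook_pair n k /\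
  row3_sum n k (~~ switched n k) = hook_succ n k.
Proof.
elim: n k => [//|n IH] k kn n1.
case: k kn => [|k] kn.
  rewrite /row3_sum /switched muln0 ltn0 andbF big_mkcond [in X in _ /\ X]big_mkcond.
  rewrite !big_ord_recl !big_ord0 /= /row3 /= !subn0 /hook_pair hook_eq1 //.
  by rewrite [num_SYT _](hook2_row n.+1 1).
have [lt|ge] := ltnP (2 * k.+1) n; last first.
    (* Here only c = 0 and c = 1 occur, one in each class, and they give the two hook sides at
       once. *)
    have -> : n.+1 = 2 * k.+1 + 1 by lia.
    have row0 : row3 (2 * k.+1 + 1) k.+1 0 = hook_succ (2 * k.+1 + 1) k.+1.
      rewrite /row3 /hook_succ hook2_nseq.
      have -> : 2 * k.+1 + 0 <= 2 * k.+1 + 1 by lia.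
      have -> : 2 * k.+1 < 2 * k.+1 + 1 by lia.
      have -> : 2 * k.+1 + 1 - 2 * k.+1 - 1 = 0 by lia.
      have -> : 2 * k.+1 + 1 - k.+1 - 0 = k.+2 by lia.
      by rewrite -(@hook2_pad k.+2 k.+1 0 1); last lia.
    have row1 : row3 (2 * k.+1 + 1) k.+1 1 = hook_pair (2 * k.+1 + 1) k.+1.
      rewrite /row3 /hook_pair /hook_eq.
      have -> : (0 < k.+2) && (2 * k.+2 <= 2 * k.+1 + 1) = false by lia.
      have -> : (0 < k.+1) && (2 * k.+1 <= 2 * k.+1 + 1) by lia.
      have -> : (1 <= k.+1) && (2 * k.+1 + 1 <= 2 * k.+1 + 1) by lia.
      have -> : 2 * k.+1 + 1 - 2 * k.+1 = 1 by lia.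
      have -> : 2 * k.+1 + 1 - k.+1 - 1 = k.+1 by lia.
      by rewrite addn0.
    have rsum e : row3_sum (2 * k.+1 + 1) k.+1 e =
        if odd k.+1 == e then hook_succ (2 * k.+1 + 1) k.+1
        else hook_pair (2 * k.+1 + 1) k.+1.
      rewrite /row3_sum big_mkcond !big_ord_recl /= row0 row1 big1.
        rewrite !addn0 /bump /= (addn1 k) /=.
        by case: (odd k); case: e; rewrite ?addn0.
      move=> i _; have -> : row3 (2 * k.+1 + 1) k.+1 (bump 0 (bump 0 i)) = 0.
        by rewrite /row3 ifF // /bump /=; lia.
      exact: if_same.
    rewrite !rsum /switched.
    have -> : odd (2 * k.+1 + 1 + k.+1) = ~~ odd k.+1 by lia.
    case ok: (odd k.+1) => //=.
    case: ltnP => //= le3.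
    (* An even k + 1 with k + 1 <= 3 is 2, so the size is 5 and lies on the line where both sides
       agree. *)
    have -> : k = 1 by lia.
    by rewrite (hook_pair_succ 0).
  have [m m0 En] : exists2 m, 0 < m & n = 2 * k.+1 + m by exists (n - 2 * k.+1); lia.
  (* Both classes at k + 1 enter the recursion together, so their order is irrelevant. *)
  have total : row3_sum n k.+1 true + row3_sum n k.+1 false
      = hook_pair n k.+1 + hook_succ n k.+1.
    have [|] := IH k.+1 lt; first by lia.
    by case: switched => /= <- <-; rewrite // addnC.
  have [prev_sw prev_nsw] : row3_sum n k (switched n.+1 k.+1) = hook_pair n k /\
      row3_sum n k (~~ switched n.+1 k.+1) = hook_succ n k.
    have [||H1 H2] := IH k; try lia.
    case: (eqVneq (switched n.+1 k.+1) (switched n k)) => [->//|ne].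
    (* Both conditions require n + k odd; their bounds n < 3k and n + 2 < 3k then disagree only at n
       = 3k - 1, as n = 3k - 2 makes n + k even. *)
    have eq_pair : hook_pair n k = hook_succ n k.
      have [j [-> ->]] : exists j, k = j.+2 /\ n = 3 * j + 5.
        exists (k - 2); move: ne; rewrite /switched.
        rewrite addSn addnS /= negbK; case: (boolP (odd (n + k))) => //= o ne.
        by case: (ltnP (n.+1 + 2) (3 * k.+1)) ne; case: (ltnP (n + 2) (3 * k)) => //; lia.
      exact: hook_pair_succ.
    have -> : switched n.+1 k.+1 = ~~ switched n k by move: ne; do 2 case: switched.
    by rewrite negbK H1 H2 eq_pair.
(* The class of [hook_pair] is free of defects: a third row defect needs 3k + 3 <= n, a second row
   one n <= 3k, and n = 3k makes n + k even. *)
have third0 : switched n.+1 k.+1 -> third_row_defect n k = 0.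
  by move=> /andP[_ sw]; rewrite /third_row_defect /row3 ifF //; lia.
have second0 : odd (n + k) != switched n.+1 k.+1 -> second_row_defect n k = 0.
  rewrite /second_row_defect /row3 /switched => sw; rewrite ifF //.
  move: sw; rewrite addSn addnS /= negbK; case: (boolP (odd (n + k))) => /=; lia.
have n2k : 2 * k <= n by lia.
have := row3_sum_rec (switched n.+1 k.+1) n2k.
have := row3_sum_rec (~~ switched n.+1 k.+1) n2k.
rewrite negbK prev_sw prev_nsw hook_pair_rec //.
have := hook_succ_rec k m0; rewrite -En /=.
move: third0 second0 total; case: switched; case: odd => /= t0 s0;
  rewrite ?(t0 isT) ?(s0 isT); lia.
Qed.

(** * From sets of triples to sums over the third part *)

(** A triple in X is determined by its third part c; values of c that yield no partition contribute
    0 on both sides. *)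
Lemma sum_three_part n k (X : {set 3.-tuple 'I_n.+1}) e : 2 * k <= n ->
  (forall l, (l \in X) = [&& is_partition_of n (parts l), nth 0 (parts l) 1 == k
     & odd (k + nth 0 (parts l) 2) == e]) ->
  \sum_(l in X) num_SYT (parts l) = row3_sum n k e.
Proof.
move=> kn inX.
pose h (c : 'I_n.+1) : 3.-tuple 'I_n.+1 := [tuple inord (n - k - c); inord k; c].
have hE c : parts (h c) = [:: n - k - c; k; nat_of_ord c].
  by rewrite /parts /= !inordK //; lia.
rewrite (reindex_onto h (fun l => tnth l (inord 2))) => [|l]; last first.
  rewrite inX; case: l => -[|x [|y [|z []]]] //= sz /andP[/andP[_ /= /eqP s] /andP[/eqP y_k _]].
  apply: val_inj; rewrite /= (tnth_nth ord0) /= inordK //=.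
  congr [:: _; _; _]; apply: val_inj; rewrite /= inordK //; lia.
have h2 c : tnth (h c) (inord 2) = c by rewrite (tnth_nth ord0) /= inordK.
rewrite (@row3_sumE _ _ _ n.+1); last lia.
rewrite big_mkord -big_mkcond.
rewrite (bigID (fun c : 'I_n.+1 => (c <= k) && (2 * k + c <= n))) /=.
rewrite [X in _ + X]big1 ?addn0 => [|c]; last first.
  rewrite h2 eqxx andbT inX hE /is_partition_of /= => /andP[] H1 H2; lia.
rewrite big_mkcond [RHS]big_mkcond; apply: eq_bigr => c _.
rewrite h2 eqxx andbT inX hE /is_partition_of /= eqxx andbT /row3.
case: (boolP ((c <= k) && (2 * k + c <= n))) => H; last by rewrite andbF if_same.
rewrite andbT; have -> : c <= k by lia.
have -> : k <= n - k - c by lia.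
by have -> : n - k - c + (k + (c + 0)) == n by lia.
Qed.

Theorem theorem1p3 (n k : nat) (n_gt0 : 0 < n) (k_gt0 : 0 < k)
    (k_le : 2 * k + 2 <= n) :
  ((k <= ceil_div n 3 \/ k = n %[mod 2]) ->
     \sum_(l in X0 n k) num_SYT (parts l)
       = num_SYT ([:: k; k] ++ nseq (n - 2 * k) 1)
         + num_SYT ([:: k.+1; k.+1] ++ nseq (n - 2 * k - 2) 1)
     /\ \sum_(l in X1 n k) num_SYT (parts l)
       = num_SYT ([:: k.+1; k] ++ nseq (n - 2 * k - 1) 1))
  /\
  ((ceil_div n 3 < k /\ k <> n %[mod 2]) ->
     \sum_(l in X1 n k) num_SYT (parts l)
       = num_SYT ([:: k; k] ++ nseq (n - 2 * k) 1)
         + num_SYT ([:: k.+1; k.+1] ++ nseq (n - 2 * k - 2) 1)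
     /\ \sum_(l in X0 n k) num_SYT (parts l)
       = num_SYT ([:: k.+1; k] ++ nseq (n - 2 * k - 1) 1)).
Proof.
have kn : 2 * k <= n by lia.
have k_lt : 2 * k < n by lia.
have n1 : 1 < n by lia.
have S0 : \sum_(l in X0 n k) num_SYT (parts l) = row3_sum n k false.
  apply: sum_three_part => // l; rewrite inE; congr [&& _, _ & _].
  by rewrite !modn2 oddD; do 2 case: odd.
have S1 : \sum_(l in X1 n k) num_SYT (parts l) = row3_sum n k true.
  apply: sum_three_part => // l; rewrite inE; congr [&& _, _ & _].
  by rewrite !modn2 oddD; do 2 case: odd.
have -> : num_SYT ([:: k; k] ++ nseq (n - 2 * k) 1)
    + num_SYT ([:: k.+1; k.+1] ++ nseq (n - 2 * k - 2) 1) = hook_pair n k.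
  have le : 2 * k.+1 <= n by lia.
  by rewrite /hook_pair /hook_eq k_gt0 kn le mulnSr subnDA.
have -> : num_SYT ([:: k.+1; k] ++ nseq (n - 2 * k - 1) 1) = hook_succ n k.
  by rewrite /hook_succ k_gt0 k_lt.
rewrite S0 S1; have [p p0] := row3_sumP k_lt n1.
have sw3 : (ceil_div n 3 < k) = (n + 2 < 3 * k) by rewrite /ceil_div /=; lia.
split=> [H0 | [H1 H2]].
  have sw : switched n k = false.
    apply/negP=> /andP[o lt]; case: H0; first by rewrite leqNgt sw3 lt.
    by rewrite !modn2; move: o; rewrite oddD; do 2 case: odd.
  by move: p p0; rewrite sw.
have sw : switched n k.
  rewrite /switched -sw3 H1 andbT oddD.
  by move: H2; rewrite !modn2; do 2 case: odd.
by move: p p0; rewrite sw.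
Qed.
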